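(* Let $l\ge 0$ and $0\le d\le l$ be integers and let $P\in\mathbb{C}[X_0,X_1]_l\setminus\{0\}$. The dimension $s:=\dim(C^d_P)$ depends only on $d$ and the cactus rank $r=\mathrm{crank}(P)$ of $P$: (1) For $0\le d\le[\frac{l}{2}]$, the function $s=s(r)$ is given by $$s(r)=\begin{cases} l-d-(r-1) & \text{if } 1\le r\le d+1,\\ l-2d & \text{if } d+1\le r\le[\frac{l}{2}]+1.\end{cases}$$ (2) For $[\frac{l}{2}]\le d\le l$, the function $s=s(r)$ is given by $$s(r)=\begin{cases} l-d-(r-1) & \text{if } 1\le r\le l-d+1,\\ 0 & \text{if } l-d+1\le r\le[\frac{l}{2}]+1.\end{cases}$$
   Context: $\mathbb{C}[X_0,X_1]_k$ is the space of homogeneous polynomials of degree $k$. For $Q\in\mathbb{C}[\xi_0,\xi_1]$ and $P\in\mathbb{C}[X_0,X_1]$ put $Q\bullet P:=Q(\frac{\partial}{\partial X_0},\frac{\partial}{\partial X_1})(P)$. For $P\in\mathbb{C}[X_0,X_1]_l$ and $0\le d\le l$, $$C^d_P:=\mathrm{coker}\big(\mathbb{C}[\xi_0,\xi_1]_d\ni Q\mapsto Q\bullet P\in\mathbb{C}[X_0,X_1]_{l-d}\big).$$ The apolar ideal of $P$ is $\mathrm{Ann}(P)=\{Q\in\mathbb{C}[\xi_0,\xi_1]\mid Q\bullet P=0\}$. The cactus rank $\mathrm{crank}(P)$ of a non-trivial binary form $P$ is the minimal length of a $0$-dimensional subscheme $Z\subset\mathbb{P}^1_{\mathbb{C}}$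 defined by a homogeneous saturated ideal $I_Z$ contained in $\mathrm{Ann}(P)$. $[x]$ denotes the integer part of $x$. *)

(* Defs.v *)
From HB Require Import structures.
From mathcomp Require Import all_boot all_order all_algebra ring_quotient.
From mathcomp Require Import boolp reals complex.
From mathcomp Require Import ssrcomplements mpoly.

Set Implicit Arguments.
Unset Strict Implicit.
Unset Printing Implicit Defensive.

Import GRing.Theory.
Import VectorInternalTheory.

Local Open Scope quotient_scope.
Local Open Scope ring_scope.

Section QuotientSpace.
Variables (F : fieldType) (V : vectType F) (U : {vspace V}).

Definition vquot := Quotient.quot (pred_of_vspace U).

HB.instance Definition _ := Choice.on vquot.
HB.instance Definition _ := GRing.Zmodule.on vquot.

Definition vquot_pi (x : V) : vquot := \pi_(Quotient.quot (pred_of_vspace U)) x.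
Definition vquot_repr (q : vquot) : V :=
  repr (q : Quotient.quot (pred_of_vspace U)).

Lemma vquot_reprK : cancel vquot_repr vquot_pi.
Proof. by move=> q; rewrite /vquot_pi /vquot_repr reprK. Qed.

Lemma vquot_piE x y : (vquot_pi x = vquot_pi y) <-> (x - y \in U).
Proof.
rewrite -[x - y \in U]/(x - y \in (pred_of_vspace U : zmodClosed V)).
by rewrite Quotient.idealrBE; split => /eqP.
Qed.

Lemma vquot_piB x y : vquot_pi (x - y) = vquot_pi x - vquot_pi y.
Proof. exact: raddfB. Qed.

Lemma vquot_piD x y : vquot_pi (x + y) = vquot_pi x + vquot_pi y.
Proof. exact: raddfD. Qed.

Lemma vquot_pi_repr x : vquot_repr (vquot_pi x) - x \in U.
Proof. by apply/vquot_piE; rewrite vquot_reprK. Qed.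

Definition vquot_scale (a : F) (q : vquot) : vquot :=
  vquot_pi (a *: vquot_repr q).

Lemma vquot_piZ a x : vquot_pi (a *: x) = vquot_scale a (vquot_pi x).
Proof.
apply/vquot_piE; rewrite -scalerBr -opprB scalerN memvN memvZ //.
exact: vquot_pi_repr.
Qed.

Fact vquot_scaleA a b q :
  vquot_scale a (vquot_scale b q) = vquot_scale (a * b) q.
Proof. by rewrite -[q]vquot_reprK -!vquot_piZ scalerA. Qed.

Fact vquot_scale1 : left_id 1 vquot_scale.
Proof. by move=> q; rewrite -[q]vquot_reprK -vquot_piZ scale1r. Qed.

Fact vquot_scaleDr : right_distributive vquot_scale +%R.
Proof.
move=> a p q; rewrite -[p]vquot_reprK -[q]vquot_reprK.
by rewrite -vquot_piD -!vquot_piZ -vquot_piD scalerDr.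
Qed.

Fact vquot_scaleDl q : {morph vquot_scale^~ q : a b / a + b}.
Proof.
move=> a b /=; rewrite -[q]vquot_reprK.
by rewrite -!vquot_piZ -vquot_piD scalerDl.
Qed.

HB.instance Definition _ := GRing.Zmodule_isLmodule.Build F vquot
  vquot_scaleA vquot_scale1 vquot_scaleDr vquot_scaleDl.

Fact vquot_pi_linear : linear vquot_pi.
Proof. by move=> a x y; rewrite vquot_piD vquot_piZ. Qed.

HB.instance Definition _ :=
  GRing.isLinear.Build F V vquot *:%R vquot_pi vquot_pi_linear.

Fact vquot_vect_axiom : vector_axiom (\dim U^C) vquot.
Proof.
pose W := (U^C)%VS.
have UW0 : (W :&: U = 0)%VS by rewrite capvC capv_compl.
have UWT (x : V) : x \in (W + U)%VS by rewrite addvC addv_complf memvf.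
pose p x := vsproj W (daddv_pi W U x).
have pE x y : x - y \in U -> p x = p y.
  move=> xyU; apply: subr0_eq; rewrite /p -!linearB /=.
  have := daddv_pi_add UW0 (UWT (x - y)).
  have -> : daddv_pi U W (x - y) = x - y.
    by apply: daddv_pi_id; rewrite // capv_compl.
  by move/(canRL (addrK _)); rewrite subrr => ->; rewrite linear0.
have pK w : p (vsval w) = w by rewrite /p daddv_pi_id ?subvsP // vsvalK.
have Kp x : vsval (p x) - x \in U.
  rewrite /p vsprojK ?memv_pi // -{2}(daddv_pi_add UW0 (UWT x)) opprD addrA.
  by rewrite subrr sub0r memvN memv_pi.
pose f (q : vquot) : 'rV_(\dim U^C) := v2r (p (vquot_repr q)).
exists f.
  move=> a q r; rewrite /f.
  rewrite (_ : p _ = a *: p (vquot_repr q) + p (vquot_repr r)) ?linearP //.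
  rewrite /p -!linearP; apply: pE; apply/vquot_piE.
  by rewrite vquot_reprK vquot_pi_linear !vquot_reprK.
exists (fun v => vquot_pi (vsval (r2v v : subvs_of W))) => [q|v].
  rewrite /f v2rK -[RHS]vquot_reprK; apply/vquot_piE; exact: Kp.
rewrite /f (_ : p _ = r2v v) ?r2vK // -[RHS]pK; apply: pE; exact: vquot_pi_repr.
Qed.

HB.instance Definition _ := Lmodule_hasFinDim.Build F vquot vquot_vect_axiom.

Lemma dim_vquot : \dim {:vquot} = (\dim {:V} - \dim U)%N.
Proof. by rewrite dimvf -dimv_compl. Qed.

End QuotientSpace.

Definition coker (F : fieldType) (V W : vectType F) (f : 'Hom(V, W)) :=
  vquot (limg f).

HB.instance Definition _ (F : fieldType) (V W : vectType F) (f : 'Hom(V, W)) :=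
  Vector.on (coker f).

Section Apolarity.
Variable F : fieldType.

(* The same type represents the forms in X_0, X_1 and those in the dual        *)
(* variables xi_0, xi_1.                                                      *)
Definition binform (k : nat) := dhomog 2 F k.

HB.instance Definition _ k := SubChoice.on (binform k).
HB.instance Definition _ k := Vector.on (binform k).

Definition diffop (Q P : {mpoly F[2]}) : {mpoly F[2]} :=
  \sum_(m <- msupp Q) Q@_m *: mderivm m P.

Lemma diffopwE k Q P : (msize Q <= k)%N ->
  diffop Q P = \sum_(m : 'X_{1..2 < k}) Q@_m *: mderivm m P.
Proof.
move=> leQk; rewrite /diffop (big_mksub 'X_{1..2 < k}) /=; first last.
- by move=> m /msize_mdeg_lt /leq_trans; apply.
- exact: msupp_uniq.
rewrite big_rmcond //= => m /memN_msupp_eq0 ->.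
by rewrite scale0r.
Qed.

Lemma diffopDl a Q Q' P :
  diffop (a *: Q + Q') P = a *: diffop Q P + diffop Q' P.
Proof.
pose k := maxn (msize Q) (maxn (msize Q') (msize (a *: Q + Q'))).
rewrite !(diffopwE (k := k)) ?leq_max ?leqnn ?orbT //.
rewrite scaler_sumr -big_split /=; apply: eq_bigr => m _.
by rewrite mcoeffD mcoeffZ scalerDl scalerA.
Qed.

Lemma diffop_homog d l Q P :
  Q \is d.-homog -> P \is l.-homog -> diffop Q P \is (l - d).-homog.
Proof.
move=> /dhomogP Qd /dhomogP Pl; rewrite /diffop big_seq.
apply: rpred_sum => m mQ; apply: rpredZ; apply/dhomogP => m'.
rewrite mcoeff_msupp mcoeff_mderivm => nz.
have /Pl /= : (m + m')%MM \in msupp P.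
  by rewrite mcoeff_msupp; apply: contraNneq nz => ->; rewrite mul0rn.
by rewrite mdegD (Qd _ mQ) => <-; rewrite addKn.
Qed.

Definition apolar_fun l d (P : binform l) (Q : binform d) : binform (l - d) :=
  DHomog (diffop_homog (dhomog_is_dhomog Q) (dhomog_is_dhomog P)).

Fact apolar_fun_linear l d (P : binform l) : linear (@apolar_fun l d P).
Proof. by move=> a Q Q'; apply/val_inj; rewrite /= diffopDl. Qed.

HB.instance Definition _ l d (P : binform l) :=
  GRing.isLinear.Build F (binform d) (binform (l - d)) *:%R (@apolar_fun l d P)
    (@apolar_fun_linear l d P).

Definition apolar_map l d (P : binform l) : 'Hom(binform d, binform (l - d)) :=
  linfun (@apolar_fun l d P).

Definition apolar_coker l d (P : binform l) := coker (@apolar_map l d P).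

HB.instance Definition _ l d (P : binform l) := Vector.on (@apolar_coker l d P).

Definition Ann (P : {mpoly F[2]}) : {pred {mpoly F[2]}} :=
  fun Q => diffop Q P == 0.

Definition homogeneous_pred (I : {pred {mpoly F[2]}}) : Prop :=
  forall Q k, Q \in I -> pihomog mdeg k Q \in I.

Definition saturated_pred (I : {pred {mpoly F[2]}}) : Prop :=
  forall Q, (exists k, forall M : binform k, (M : {mpoly F[2]}) * Q \in I) ->
    Q \in I.

(* h is the dimension of the degree k part of F[xi_0, xi_1] / I.              *)
Definition hilbert_value (I : {pred {mpoly F[2]}}) (k h : nat) : Prop :=
  exists2 U : {vspace binform k},
    forall Q : binform k, (Q \in U) = ((Q : {mpoly F[2]}) \in I) &
    \dim {:vquot U} = h.

(* A 0-dimensional subscheme Z of P^1 is represented by its homogeneous       *)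
(* saturated ideal; its length is the value of its (constant) Hilbert         *)
(* polynomial. The ideals satisfying idealr_closed are proper, that is, Z is  *)
(* not empty.                                                                 *)
Definition finite_subscheme (I : {pred {mpoly F[2]}}) (n : nat) : Prop :=
  [/\ idealr_closed I, homogeneous_pred I, saturated_pred I &
      exists k0, forall k, (k0 <= k)%N -> hilbert_value I k n].

Definition apolar_length (P : {mpoly F[2]}) (n : nat) : Prop :=
  exists2 I, finite_subscheme I n & {subset I <= Ann P}.

(* By convention 0 if there is no apolar 0-dimensional subscheme.             *)
Definition crank (P : {mpoly F[2]}) : nat :=
  if pselect (exists n, `[< apolar_length P n >]) is left ex
  then ex_minn ex else 0%N.

End Apolarity.

Arguments apolar_coker {F l} d P.

(* Main.v *)
Require Import Defs.
From HB Require Import structures.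
From mathcomp Require Import all_boot all_order all_algebra.
From mathcomp Require Import reals complex mpoly.
From mathcomp Require Import boolp zify.

(**
Write a(k) = dim Ann(P)_k. The crank of P is the least r with a(r) > 0: a
nonzero form g of Ann(P)_r generates a saturated ideal of length r. Conversely,
let I be a saturated ideal of length n; in large degrees dim I_k = k + 1 - n,
so that xi_0 I_k + xi_1 I_k has dimension at most dim I_k + 1. For nonzero
W in F[xi_0, xi_1]_k one always has dim (xi_0 W + xi_1 W) > dim W, and equality
dim W + 1 forces W to be all the multiples of some form of degree
k + 1 - dim W; hence I contains a form of degree n.

The pairing (Q, Q') |-> (Q Q') . P identifies the rank of the apolarity map in
degree d with the one in degree l - d, so the Hilbert function
h(k) = k + 1 - a(k) satisfies h(k) = h(l - k). It equals k + 1 for k < r and is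
nonincreasing from r - 1 on. Since h(r - 1) = r = h(l - r + 1), it is equal to r
between r - 1 and l - r + 1.
*)

Set Implicit Arguments.
Unset Strict Implicit.
Unset Printing Implicit Defensive.

Import GRing.Theory Num.Theory.

Local Open Scope ring_scope.

(** * Divisibility by monomials *)

Section MonomialDivisibility.
Variables (n : nat) (R : idomainType).
Implicit Types (A B C : {mpoly R[n]}) (k m : 'X_{1..n}).

Lemma mcoeffMX_eq0 A k m : ~~ (k <= m)%MM -> (A * 'X_[k])@_m = 0.
Proof.
move=> nkm; apply: memN_msupp_eq0; rewrite (perm_mem (msuppMX A k)).
by apply: contra nkm => /mapP[m' _ ->]; exact: lem_addr.
Qed.

Lemma mpolyX_dvdP A k :
  (forall m, ~~ (k <= m)%MM -> A@_m = 0) -> exists C, A = C * 'X_[k].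
Proof.
move=> A0; exists (\sum_(m <- msupp A) A@_m *: 'X_[(m - k)%MM]).
rewrite {1}[A]mpolyE mulr_suml !big_seq; apply: eq_bigr => m mA.
rewrite -scalerAl -mpolyXD submK //; apply: contraLR mA => /A0.
by rewrite mcoeff_msupp => ->; rewrite eqxx.
Qed.

(** Shifting [m] by [U_(i) *+ a] keeps its exponent at [j], so the coefficients of [A] with exponent
    below [b] at [j] vanish with those of [B * 'X_[U_(j) *+ b]]. *)
Lemma mpolyXU_coprime (i j : 'I_n) a b A B : i != j ->
  A * 'X_[U_(i) *+ a] = B * 'X_[U_(j) *+ b] ->
  exists C, A = C * 'X_[U_(j) *+ b].
Proof.
move=> neq_ij eqAB; apply: mpolyX_dvdP => m nle.
rewrite -(mcoeffMX A (U_(i) *+ a)) eqAB mcoeffMX_eq0 //.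
apply: contra nle => /mnm_lepP le; apply/mnm_lepP => t.
have := le t; rewrite mnmDE !mulmnE !mnm1E.
by case: (eqVneq j t) => [<-|_]; rewrite ?mul0n // (negbTE neq_ij) mul0n.
Qed.

End MonomialDivisibility.

(** * Multiplication of binary forms and growth of spaces of forms *)

Section BinaryForms.
Variable F : fieldType.
Implicit Types (a b k : nat).

(** Serves to replace an arbitrary cofactor [A] of a form by a homogeneous one. *)
Lemma pihomogM a b (A g : {mpoly F[2]}) : g \is (a).-homog ->
  pihomog mdeg (a + b) (A * g) = pihomog mdeg b A * g.
Proof.
move=> gh; pose N := maxn b.+1 (mmeasure mdeg A).
rewrite {1}(pihomog_partitionE (leq_maxr b.+1 _ : _ <= N)%N).
have ltbN : (b < N)%N by rewrite leq_max ltnSn.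
rewrite mulr_suml linear_sum /= (bigD1 (Ordinal ltbN)) //= big1 ?addr0.
  by rewrite pihomog_dE // addnC; apply: dhomogM => //; exact: pihomogP.
move=> [i ltiN] /=; rewrite -val_eqE /= => neq_ib.
apply: (@pihomog_ne0 _ _ _ (i + a)%N); first by rewrite addnC eqn_add2l.
by apply: dhomogM => //; exact: pihomogP.
Qed.

Lemma pihomogM_lt a k (A g : {mpoly F[2]}) : g \is (a).-homog -> (k < a)%N ->
  pihomog mdeg k (A * g) = 0.
Proof.
move=> gh ltka; rewrite {1}(pihomog_partitionE (leqnn (mmeasure mdeg A))).
rewrite mulr_suml linear_sum /= big1 // => i _.
apply: (@pihomog_ne0 _ _ _ (i + a)%N); first by lia.
by apply: dhomogM => //; exact: pihomogP.
Qed.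

Lemma dim_binform k : \dim {: binform F k} = k.+1.
Proof. by rewrite dimvf /dim /= addn1 binSn. Qed.

Fact mulform_homog a b (g : binform F a) (A : binform F b) :
  (A : {mpoly F[2]}) * g \is (a + b).-homog.
Proof. by rewrite addnC; apply: dhomogM; exact: dhomog_is_dhomog. Qed.

(** With the degree written [a + b], a linear form maps into degree [1 + b], which is convertible to
    [b.+1], as [grow] requires. *)
Definition mulform_fun a b (g : binform F a) (A : binform F b) :
  binform F (a + b) := DHomog (mulform_homog g A).

Fact mulform_fun_linear a b (g : binform F a) : linear (@mulform_fun a b g).
Proof. by move=> c A B; apply/val_inj; rewrite /= mulrDl scalerAl. Qed.

HB.instance Definition _ a b (g : binform F a) :=
  GRing.isLinear.Build F (binform F b) (binform F (a + b)) *:%R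
    (@mulform_fun a b g) (@mulform_fun_linear a b g).

Definition mulform a b (g : binform F a) :
  'Hom(binform F b, binform F (a + b)) := linfun (@mulform_fun a b g).

Lemma mulformE a b (g : binform F a) (A : binform F b) :
  (mulform b g A : {mpoly F[2]}) = (A : {mpoly F[2]}) * g.
Proof. by rewrite lfunE. Qed.

Lemma mulform_inj a b (g : binform F a) : g != 0 -> injective (mulform b g).
Proof.
move=> g0 A B /(congr1 val) /=; rewrite !mulformE => eqAB.
by apply/val_inj; apply: (mulIf _ eqAB); rewrite -(inj_eq val_inj) in g0.
Qed.

Lemma dim_mulform a b (g : binform F a) (W : {vspace binform F b}) : g != 0 ->
  \dim (mulform b g @: W) = \dim W.
Proof.
move=> /(@mulform_inj a b)/lker0P/eqP ker0.
by rewrite limg_dim_eq // ker0 capv0.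
Qed.

Fact xi_homog i : 'X_i \is [in F[2], 1.-homog].
Proof. by rewrite dhomogX /= mdeg1. Qed.

Definition xi i : binform F 1 := DHomog (xi_homog i).

Lemma xi_neq0 i : xi i != 0.
Proof.
apply/eqP => /(congr1 (fun A : binform F 1 => (A : {mpoly F[2]})@_U_(i))).
by move/eqP; rewrite /= mcoeffX eqxx mcoeff0 oner_eq0.
Qed.

Definition grow k (W : {vspace binform F k}) : {vspace binform F k.+1} :=
  (mulform k (xi 0) @: W + mulform k (xi 1) @: W)%VS.

(* Otherwise xi_1 W would be contained in xi_0 W, and every element of W would
   be divisible by all powers of xi_0. *)
Lemma dim_grow k (W : {vspace binform F k}) : W != 0%VS ->
  (\dim W < \dim (grow W))%N.
Proof.
apply: contraNT; rewrite -leqNgt -(dim_mulform W (xi_neq0 0)) => le_dim.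
have sub0 : (mulform k (xi 0) @: W <= grow W)%VS by exact: addvSl.
have eqW : (mulform k (xi 0) @: W)%VS = grow W.
  by apply/eqP; rewrite -(dimv_leqif_eq sub0).2 eqn_leq le_dim (dimvS sub0).
rewrite -subv0; apply/subvP => w wW; rewrite memv0; apply/eqP/val_inj/mpolyP.
move=> m; rewrite /= mcoeff0; have [j] := ubnP (m 0).
elim: j w wW m => // j IHj w wW m lt_m.
have : mulform k (xi 1) w \in (mulform k (xi 0) @: W)%VS.
  by rewrite eqW; apply: subvP (addvSr _ _) _ _; exact: memv_img.
case/memv_imgP => w' w'W /(congr1 val) /=; rewrite !mulformE /= => eqw.
(* The coefficient of [w] at [m] is zero or a coefficient of [w'] whose exponent of xi_0 is one
   smaller. *)
rewrite -(mcoeffMX w U_(1%R)) eqw.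
have [le_m|nle_m] := boolP (U_(0%R) <= U_(1%R) + m)%MM;
  last exact: mcoeffMX_eq0.
rewrite -(submK le_m) addmC mcoeffMX IHj //.
by move/mnm_lepP/(_ 0): le_m; rewrite mnmBE !mnmDE !mnm1E /=; lia.
Qed.

(* The descent replaces W by the space of all Q with xi_0 Q, xi_1 Q in W. *)
Lemma grow_principal n k (W : {vspace binform F k}) :
  \dim W = n.+1 -> (\dim (grow W) <= n.+2)%N ->
  exists r (g : binform F r), [/\ g != 0, (r + n)%N = k &
    forall m, mdeg m = n -> exists2 w : binform F k, w \in W &
      (w : {mpoly F[2]}) = 'X_[m] * g].
Proof.
elim: n k W => [|n IHn] k W dimW dim_gW.
  exists k, (vpick W); split; rewrite ?addn0 //.
    by rewrite vpick0 -dimv_eq0 dimW.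
  move=> m /eqP; rewrite mdeg_eq0 => /eqP ->; exists (vpick W) => //.
    exact: memv_pick.
  by rewrite mpolyX0 mul1r.
case: k => [|k] in W dimW dim_gW *.
  by have := dimvS (subvf W); rewrite dim_binform dimW.
pose W' := (mulform k (xi 0) @^-1: W :&: mulform k (xi 1) @^-1: W)%VS.
(* If xi_0 A = xi_1 B, then A = xi_1 D and B = xi_0 D with D in [W']. Hence dim [W'] is at least dim
   (X ∩ Y), which is at least 2(n + 2) - (n + 3). *)
have dimW'_ge : (n < \dim W')%N.
  pose X := (mulform k.+1 (xi 0) @: W)%VS.
  pose Y := (mulform k.+1 (xi 1) @: W)%VS.
  have : (X :&: Y <= mulform k.+1 (xi 0) @: (mulform k (xi 1) @: W'))%VS.
    apply/subvP => Q; rewrite memv_cap => /andP[].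
    case/memv_imgP => A AW -> /memv_imgP[B BW] eqAB.
    have := congr1 val eqAB; rewrite /= !mulformE /=.
    rewrite -[U_(0%R)%MM]mulm1n -[U_(1%R)%MM]mulm1n => eqAB'.
    have [C eqAC] := mpolyXU_coprime (isT : 0 != 1 :> 'I_2) eqAB'.
    pose D : binform F k := DHomog (pihomogP mdeg k C).
    have eqA : A = mulform k (xi 1) D.
      apply/val_inj; rewrite /= mulformE /= -(pihomogM _ _ (xi_homog 1)).
      rewrite -[U_(1%R)%MM]mulm1n -eqAC pihomog_dE //.
      exact: dhomog_is_dhomog.
    have eqB : B = mulform k (xi 0) D.
      apply: (mulform_inj (xi_neq0 1)); apply/val_inj.
      by rewrite -eqAB eqA /= !mulformE /= mulrAC.
    rewrite eqA; apply/memv_img/memv_img.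
    by rewrite memv_cap -!memv_preim -eqA -eqB AW BW.
  move/dimvS; rewrite (dim_mulform _ (xi_neq0 0)) (dim_mulform _ (xi_neq0 1)).
  apply: leq_trans; have := dimv_sum_cap X Y.
  rewrite (dim_mulform W (xi_neq0 0)) (dim_mulform W (xi_neq0 1)) dimW.
  have arith x y : (x <= n.+3 -> x + y = n.+2 + n.+2 -> n < y)%N by lia.
  exact: arith dim_gW.
have gW'_sub : (grow W' <= W)%VS.
  rewrite subv_add; apply/andP; split; apply/subvP => Q /memv_imgP[A AW' ->].
    by move: AW'; rewrite memv_cap -!memv_preim => /andP[].
  by move: AW'; rewrite memv_cap -!memv_preim => /andP[].
have W'_neq0 : W' != 0%VS by rewrite -dimv_eq0; lia.
(* The chain n + 1 <= dim W' < dim (grow W') <= dim W = n + 2 leaves no slack, so [W'] meets the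
   hypotheses of the induction. *)
have := dim_grow W'_neq0; have := dimvS gW'_sub; rewrite dimW => le1 lt1.
have dimW' : \dim W' = n.+1.
  by apply/eqP; rewrite eqn_leq dimW'_ge andbT -ltnS (leq_trans lt1 le1).
have [r [g [g0 eqk gW']]] := IHn k W' dimW' le1; subst k.
exists r, g; split; rewrite ?addnS // => m dm.
have [i mi] : exists i, (U_(i) <= m)%MM.
  have /existsP[i mi] : [exists i, m i != 0%N].
    apply: contraTT isT; rewrite negb_exists => /forallP m0.
    suff: m == 0%MM by rewrite -mdeg_eq0 dm.
    apply/eqP/mnmP => i; rewrite mnm0E; apply/eqP.
    by move: (m0 i); rewrite negbK.
  by exists i; rewrite lep1mP.
have [|w wW' eqw] := gW' (m - U_(i))%MM.
  by apply: succn_inj; rewrite -dm -{2}(submK mi) mdegD mdeg1 addn1.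
exists (mulform (r + n) (xi i) w).
  move: wW'; rewrite memv_cap -!memv_preim => /andP[w0 w1].
  case: (unliftP 0 i) => [j ->|-> //].
  by rewrite (ord1 j) (_ : lift _ _ = 1) //; apply/val_inj.
by rewrite mulformE /= eqw mulrAC -mpolyXD submK.
Qed.

(** * The action of differential operators *)

Definition diffop_by (P Q : {mpoly F[2]}) := diffop Q P.

Fact diffop_by_linear P : linear (diffop_by P).
Proof. by move=> a Q Q'; exact: diffopDl. Qed.

HB.instance Definition _ P := GRing.isLinear.Build F {mpoly F[2]} {mpoly F[2]}
  *:%R (diffop_by P) (diffop_by_linear P).

Lemma diffopX m (P : {mpoly F[2]}) : diffop 'X_[m] P = P^`M[m].
Proof. by rewrite /diffop msuppX big_seq1 mcoeffX eqxx scale1r. Qed.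

(** By linearity in [A] and [B] this reduces to monomials, whose derivations compose by adding
    exponents. *)
Lemma diffopM (A B P : {mpoly F[2]}) : diffop (A * B) P = diffop A (diffop B P).
Proof.
rewrite -[LHS]/(diffop_by P (A * B)) {1}[A]mpolyE mulr_suml linear_sum.
apply: eq_bigr => m _; rewrite -scalerAl linearZ {1}[B]mpolyE mulr_sumr /=.
congr (_ *: _); rewrite [in RHS]/diffop !linear_sum; apply: eq_bigr => m' _.
by rewrite -scalerAr !linearZ /= -mpolyXD /diffop_by diffopX addmC mderivmDm.
Qed.

Lemma diffop1 (P : {mpoly F[2]}) : diffop 1 P = P.
Proof. by rewrite -mpolyX0 diffopX mderivm0m. Qed.

Lemma diffopDr c (Q P P' : {mpoly F[2]}) :
  diffop Q (c *: P + P') = c *: diffop Q P + diffop Q P'.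
Proof.
rewrite /diffop scaler_sumr -big_split /=; apply: eq_bigr => m _.
by rewrite linearP scalerDr !scalerA mulrC.
Qed.

Lemma diffop0r (Q : {mpoly F[2]}) : diffop Q 0 = 0.
Proof. by rewrite /diffop big1 // => m _; rewrite linear0 scaler0. Qed.

(** * Apolar schemes and forms annihilating P *)

Lemma apolar_length_form l (P : binform F l) n : P != 0 ->
  apolar_length P n -> exists2 g : binform F n, g != 0 & diffop g P = 0.
Proof.
move=> P0 [I [[I0 _ ID] _ Isat [k0 hilbI]] IAnn].
(* In this degree k + 1 - n is [k0.+1], so [grow_principal] yields a form of degree n, all of whose
   multiples by monomials of degree [k0] lie in I. *)
pose k := (k0 + n)%N.
have [U UI dimU] := hilbI k (leq_addr _ _).
have [U' UI' dimU'] := hilbI k.+1 (leqW (leq_addr _ _)).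
move: dimU dimU'; rewrite !dim_vquot !dim_binform => dimU dimU'.
have dimU0 : \dim U = k0.+1.
  by have := dimvS (subvf U); rewrite dim_binform; move: dimU; lia.
have dimU0' : \dim U' = k0.+2.
  by have := dimvS (subvf U'); rewrite dim_binform; move: dimU'; lia.
have growU : (grow U <= U')%VS.
  have xiU i A : A \in U -> mulform k (xi i) A \in U'.
    rewrite UI UI' => AI; have := ID 'X_i _ _ AI I0.
    by rewrite addr0 mulrC -(mulformE (xi i)).
  by rewrite subv_add; apply/andP; split; apply/subvP => Q /memv_imgP[A AU ->];
    exact: xiU.
have [|r [g [g0 eqk gU]]] := grow_principal dimU0.
  by rewrite -dimU0' dimvS.
have eqrn : r = n by lia.
subst r; exists g => //; apply/eqP; rewrite -[_ == _]/(_ \in Ann P).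
apply: IAnn; apply: Isat; exists k0 => M.
have sumI (s : seq 'X_{1..2}) (c : 'X_{1..2} -> F) :
    (forall m, m \in s -> 'X_[m] * (g : {mpoly F[2]}) \in I) ->
    \sum_(m <- s) c m *: 'X_[m] * (g : {mpoly F[2]}) \in I.
  move=> HI; rewrite big_seq; elim/big_rec: _ => // m Q ms QI.
  by rewrite -scalerAl -mul_mpolyC; apply: ID; rewrite ?HI.
rewrite [X in X * _]mpolyE mulr_suml; apply: sumI => m mM.
have [|w wU <-] := gU m; last by rewrite -UI.
exact: dhomog_mf (dhomog_is_dhomog M) _ mM.
Qed.

Definition principal_pred (g : {mpoly F[2]}) : {pred {mpoly F[2]}} :=
  fun Q => `[< exists A, Q = A * g >].

Lemma principal_predP (g Q : {mpoly F[2]}) :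
  reflect (exists A, Q = A * g) (Q \in principal_pred g).
Proof. exact: asboolP. Qed.

Lemma principal_homogeneous n (g : {mpoly F[2]}) : g \is n.-homog ->
  homogeneous_pred (principal_pred g).
Proof.
move=> gh Q k /principal_predP[A ->]; apply/principal_predP.
have [ltkn|lenk] := ltnP k n.
  by exists 0; rewrite mul0r (pihomogM_lt _ gh).
by exists (pihomog mdeg (k - n) A); rewrite -(pihomogM _ _ gh) subnKC.
Qed.

(* [A_0 xi_1^k = A_1 xi_0^k] forces [xi_0^k] to divide [A_0]. *)
Lemma principal_saturated (g : {mpoly F[2]}) : g != 0 ->
  saturated_pred (principal_pred g).
Proof.
move=> g0 Q [k kQ]; apply/principal_predP.
have Xh i : 'X_[U_(i) *+ k] \is [in F[2], k.-homog].
  by rewrite dhomogX /= mdegMn mdeg1 mul1n.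
have [A0 /= eqA0] := principal_predP _ _ (kQ (DHomog (Xh 0))).
have [A1 /= eqA1] := principal_predP _ _ (kQ (DHomog (Xh 1))).
have eqA : A0 * 'X_[U_(1%R) *+ k] = A1 * 'X_[U_(0%R) *+ k].
  apply: (mulIf g0); rewrite ![_ * _ * g]mulrAC -eqA0 -eqA1 ![_ * Q * _]mulrAC.
  by congr (_ * Q); exact: mulrC.
have [C eqC] := mpolyXU_coprime (isT : 1 != 0 :> 'I_2) eqA.
exists C; apply: (mulfI (_ : 'X_[U_(0%R) *+ k] != 0)).
  by rewrite -msupp_eq0 msuppX.
by rewrite eqA0 eqC mulrAC mulrC.
Qed.

Lemma principal_hilbert n k (g : binform F n) : g != 0 -> (n <= k)%N ->
  hilbert_value (principal_pred g) k n.
Proof.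
move=> g0 /subnKC <-; exists (limg (mulform (k - n) g)); last first.
  rewrite dim_vquot dim_mulform // !dim_binform; lia.
move=> Q; apply/memv_imgP/principal_predP.
  by case=> A _ ->; exists (A : {mpoly F[2]}); rewrite mulformE.
(* The component of degree k - n of the cofactor is again a cofactor, since [Q] and [g] are
   homogeneous. *)
case=> A eqQ; exists (DHomog (pihomogP mdeg (k - n) A)); first exact: memvf.
apply/val_inj; rewrite /= mulformE /= -(pihomogM _ _ (dhomog_is_dhomog g)).
by rewrite -eqQ pihomog_dE //; exact: dhomog_is_dhomog.
Qed.

Lemma apolar_length_principal n (g : binform F n) (P : {mpoly F[2]}) :
  P != 0 -> g != 0 -> diffop g P = 0 -> apolar_length P n.
Proof.
move=> P0 g0 gP; exists (principal_pred g); last first.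
  move=> Q /principal_predP[A ->]; apply/eqP.
  by rewrite diffopM gP diffop0r.
split; last by exists n => k; exact: principal_hilbert.
- split; first by apply/principal_predP; exists 0; rewrite mul0r.
    (* The ideal is proper: 1 = A g would give P = A • (g • P) = 0. *)
    apply: contra_neqN P0 => /principal_predP[A eqA].
    by rewrite -[P]diffop1 eqA diffopM gP diffop0r.
  move=> A _ _ /principal_predP[B ->] /principal_predP[C ->].
  by apply/principal_predP; exists (A * B + C); rewrite mulrDl mulrA.
- exact: principal_homogeneous (dhomog_is_dhomog g).
- exact: principal_saturated.
Qed.

End BinaryForms.

(** * Ranks of the apolarity maps *)

Lemma dim_limg_le_pairing (F : fieldType) (A B V W : vectType F)
    (f : 'Hom(A, V)) (g : 'Hom(B, W)) (beta : B -> V -> F) :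
  (forall b, scalar (beta b)) -> (forall v, scalar (beta^~ v)) ->
  (forall b, (forall a, beta b (f a) = 0) -> g b = 0) ->
  (\dim (limg g) <= \dim (limg f))%N.
Proof.
move=> betaR betaL beta0; pose X := vbasis (limg f).
(* [phi0 b] records the functional [beta b] on a basis of [limg f]. If it vanishes, [b] pairs to
   zero with the whole image and lies in [lker g]; so the rank of [g] is at most that of [phi],
   hence at most dim (limg f). *)
pose phi0 b : 'rV[F]_(\dim (limg f)) := \row_i beta b X`_i.
have phi0_linear : linear phi0.
  by move=> c b b'; apply/rowP => i; rewrite !mxE betaL.
pose phiL := GRing.isLinear.Build F B _ *:%R phi0 phi0_linear.
pose phi := linfun (HB.pack phi0 phiL : {linear B -> 'rV[F]_(\dim (limg f))}).
have ker_sub : (lker phi <= lker g)%VS.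
  apply/subvP => b; rewrite !memv_ker lfunE /= => /eqP phib0.
  apply/eqP/beta0 => a.
  have bL := GRing.isLinear.Build F V F^o *:%R (beta b) (betaR b).
  pose betab : {linear V -> F^o} := HB.pack (beta b) bL.
  rewrite -[beta b _]/(betab _) (coord_vbasis (memv_img f (memvf a))).
  rewrite linear_sum big1 // => i _; rewrite linearZ /=.
  have := congr1 (fun r : 'rV_ _ => r 0 i) phib0.
  by rewrite !mxE => ->; rewrite scaler0.
have := dimvS ker_sub; have := limg_ker_dim g fullv; rewrite capfv.
have := limg_ker_dim phi fullv; rewrite capfv.
have := dimvS (subvf (limg phi)).
rewrite [X in (_ <= X)%N]dimvf dim_matrix mul1r.
set x := \dim (limg phi); set y := \dim (limg f); lia.
Qed.

Section Catalecticant.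
Variables (F : numFieldType) (l : nat) (P : binform F l).
Implicit Types (d k : nat).

(** The two coefficients differ by a product of factorials, nonzero in characteristic zero. *)
Lemma mcoeff0_mderivm m (Q : {mpoly F[2]}) : (Q^`M[m]@_0 == 0) = (Q@_m == 0).
Proof.
rewrite mcoeff_mderivm addm0 mulrn_eq0 (negbTE (lt0n_neq0 _)) //.
by apply: prodn_gt0 => i; rewrite ffactnn fact_gt0.
Qed.

Lemma apolar_mapE k (Q : binform F k) :
  (apolar_map k P Q : {mpoly F[2]}) = diffop Q P.
Proof. by rewrite lfunE. Qed.

Lemma dim_apolar_limg d : (d <= l)%N ->
  \dim (limg (apolar_map (l - d) P)) = \dim (limg (apolar_map d P)).
Proof.
suff le k j : (k + j = l)%N ->
    (\dim (limg (apolar_map j P)) <= \dim (limg (apolar_map k P)))%N.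
  by move=> led; apply/eqP; rewrite eqn_leq !le ?subnK ?subnKC.
move=> eql; pose beta (B : binform F j) (V : binform F (l - k)) :=
  (diffop B V)@_0.
apply: (@dim_limg_le_pairing _ _ _ _ _ _ _ beta) => [B c V V'|V c B B'|B beta0].
- by rewrite /beta diffopDr mcoeffD mcoeffZ.
- by rewrite /beta diffopDl mcoeffD mcoeffZ.
apply/val_inj; rewrite /= apolar_mapE; apply/mpolyP => m; rewrite mcoeff0.
have BPh := diffop_homog (dhomog_is_dhomog B) (dhomog_is_dhomog P).
have [dm|dm] := eqVneq (mdeg m) k; last first.
  by apply: dhomog_nemf_coeff BPh _; rewrite -eql addnK.
have Xh : 'X_[m] \is [in F[2], k.-homog] by rewrite dhomogX /= dm.
(* Up to a nonzero factor, the coefficient of B • P at [m] is the constant term of X^m • (B • P) = B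
   • (X^m • P), a value of [beta B] on the image. *)
apply/eqP; rewrite -mcoeff0_mderivm -diffopX -diffopM mulrC diffopM.
by rewrite -[X in diffop _ X](apolar_mapE (DHomog Xh)) -/(beta _ _) beta0.
Qed.

(** * Graded pieces of Ann(P) and the crank *)

Definition Ann_form k : {vspace binform F k} := lker (apolar_map k P).

Lemma Ann_formP k (Q : binform F k) : (Q \in Ann_form k) = (diffop Q P == 0).
Proof.
by rewrite memv_ker -(inj_eq val_inj) /= apolar_mapE.
Qed.

Lemma dim_Ann_form k :
  (\dim (Ann_form k) + \dim (limg (apolar_map k P)) = k.+1)%N.
Proof.
by have := limg_ker_dim (apolar_map k P) fullv; rewrite capfv dim_binform.
Qed.

(** Multiplication by either variable preserves Ann(P), so [dim_grow] applies. *)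
Lemma dim_Ann_form_lt k : Ann_form k != 0%VS ->
  (\dim (Ann_form k) < \dim (Ann_form k.+1))%N.
Proof.
move/dim_grow/leq_trans; apply; apply: dimvS.
have xiA i A : A \in Ann_form k -> mulform k (xi F i) A \in Ann_form k.+1.
  rewrite !Ann_formP (mulformE (xi F i)).
  by rewrite mulrC diffopM => /eqP ->; rewrite diffop0r.
by rewrite subv_add; apply/andP; split; apply/subvP => Q /memv_imgP[A AU ->];
  exact: xiA.
Qed.

Lemma dim_Ann_form_sym d : (d <= l)%N ->
  (\dim (Ann_form (l - d)) + d = \dim (Ann_form d) + (l - d))%N.
Proof.
move=> led; have := dim_Ann_form d; have := dim_Ann_form (l - d).
rewrite dim_apolar_limg //.
set x := \dim _; set y := \dim (Ann_form d); set z := \dim _; lia.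
Qed.

(** In this degree the source of the apolarity map has larger dimension than the target, even for l
    = 0, where the target degree is truncated to 0. *)
Lemma Ann_form_half : Ann_form (l./2).+1 != 0%VS.
Proof.
rewrite -dimv_eq0; have := dim_Ann_form (l./2).+1.
have := dimvS (subvf (limg (apolar_map (l./2).+1 P))); rewrite dim_binform.
set x := \dim _; set y := \dim (Ann_form _); lia.
Qed.

Lemma apolar_lengthP n : P != 0 -> apolar_length P n <-> Ann_form n != 0%VS.
Proof.
move=> P0; split=> [/(apolar_length_form P0)[g g0 gP]|An0].
  apply: contraNneq g0 => A0; have : g \in Ann_form n by rewrite Ann_formP gP.
  by rewrite A0 memv0.
apply: (apolar_length_principal (g := vpick (Ann_form n))).
- by rewrite -(inj_eq val_inj) in P0.
- by rewrite vpick0.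
- by apply/eqP; rewrite -Ann_formP memv_pick.
Qed.

Lemma crankP : P != 0 ->
  Ann_form (crank P) != 0%VS /\
  forall k, (k < crank P)%N -> \dim (Ann_form k) = 0%N.
Proof.
move=> P0; rewrite /crank; case: pselect => [ex|[]]; last first.
  (* Excludes the default value of [crank]. *)
  by exists (l./2).+1; apply/asboolP/apolar_lengthP/Ann_form_half.
case: ex_minnP => r /asboolP/(apolar_lengthP _ P0) Ar rmin; split=> // k ltkr.
apply/eqP; rewrite dimv_eq0; apply: contraTT ltkr => Ak.
by rewrite -leqNgt; apply/rmin/asboolP/apolar_lengthP.
Qed.

Lemma crank_bounds : P != 0 -> (1 <= crank P <= l./2 + 1)%N.
Proof.
move=> P0; have [A_crank A_lt] := crankP P0; apply/andP; split.
  (* Forms of degree 0 act on P as scalars, so only 0 annihilates it. *)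
  rewrite lt0n; apply: contraNneq A_crank => ->.
  rewrite -subv0; apply/subvP => Q; rewrite memv0 Ann_formP.
  have eqQ : (Q : {mpoly F[2]}) = (Q : {mpoly F[2]})@_0 *: 1.
    apply/mpolyP => m; rewrite mcoeffZ mcoeff1.
    have [->|m0] := eqVneq m 0%MM; first by rewrite mulr1.
    rewrite mulr0; apply: dhomog_nemf_coeff (dhomog_is_dhomog Q) _.
    by rewrite mdeg_eq0.
  rewrite eqQ -[diffop _ _]/(diffop_by _ _) linearZ /= /diffop_by diffop1.
  rewrite -(inj_eq val_inj) in P0.
  rewrite scaler_eq0 (negbTE P0) orbF => /eqP Q0.
  by apply/eqP/val_inj; rewrite /= eqQ Q0 scale0r.
rewrite leqNgt addn1; apply/negP => /A_lt/eqP.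
by rewrite dimv_eq0 (negbTE Ann_form_half).
Qed.

Lemma dim_Ann_formE d : P != 0 -> (d <= l)%N ->
  (\dim (Ann_form d) + minn d.+1 (minn (l - d).+1 (crank P)) = d.+1)%N.
Proof.
move=> P0 led; have [A_crank A_lt] := crankP P0.
have := crank_bounds P0; set r := crank P in A_crank A_lt * => r_bounds.
pose a k := \dim (Ann_form k).
have a_inc k : (0 < a k -> a k < a k.+1)%N.
  by move=> ak; apply: dim_Ann_form_lt; rewrite -dimv_eq0 -lt0n.
have a_sym k : (k <= l -> a (l - k)%N + k = a k + (l - k))%N.
  exact: dim_Ann_form_sym.
have a_r : (0 < a r)%N by rewrite lt0n dimv_eq0.
have a_lt k : (k < r)%N -> a k = 0%N by exact: A_lt.
rewrite -/(a d); move: (a) a_inc a_sym a_r a_lt r_bounds => {}a a_inc a_sym.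
move=> a_r a_lt r_bounds.
have a_pos j : (j < a (r + j))%N.
  elim: j => [|j IHj]; rewrite ?addn0 // addnS.
  by apply: leq_trans (a_inc _ _); lia.
have a_mono k j : (r <= k)%N -> (a k + j <= a (k + j))%N.
  move=> lerk; elim: j => [|j IHj]; rewrite ?addn0 // !addnS.
  apply: leq_trans (a_inc _ _); first by lia.
  by have := a_pos (k + j - r)%N; rewrite subnKC; lia.
(* Below [r] the dimension is 0; symmetry then settles the degrees above l - r. *)
have [ltdr|lerd] := ltnP d r; first by rewrite a_lt //; lia.
have := a_sym d led; have [ltdr|lerd'] := ltnP (l - d) r.
  by rewrite a_lt //; lia.
(* There remains r <= d <= l - r. Symmetry at r - 1 gives a(l - r + 1) = l - 2r + 2; growth by at
   least one per degree then gives a(d) <= d - r + 1, and [a_pos] is the reverse bound. *)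
have := a_sym r.-1; rewrite (a_lt r.-1); last by lia.
have := a_mono d (l - r.-1 - d)%N lerd; rewrite subnKC; last by lia.
have := a_pos (d - r)%N; rewrite subnKC //; lia.
Qed.

End Catalecticant.
Theorem proposition1p12 (R : realType) (l d : nat) (hd : (d <= l)%N) :
  exists s : nat -> nat,
    [/\ forall P : binform R[i] l, P != 0 ->
          (1 <= crank P <= l./2 + 1)%N /\
          \dim {:apolar_coker d P} = s (crank P),
        (d <= l./2)%N ->
          (forall r, (1 <= r <= d + 1)%N -> s r = (l - d - (r - 1))%N) /\
          (forall r, (d + 1 <= r <= l./2 + 1)%N -> s r = (l - 2 * d)%N) &
        (l./2 <= d)%N ->
          (forall r, (1 <= r <= l - d + 1)%N -> s r = (l - d - (r - 1))%N) /\
          (forall r, (l - d + 1 <= r <= l./2 + 1)%N -> s r = 0%N)].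
Proof.
(* The cokernel has dimension l - d - min(d, l - d, r - 1). For d < [l/2] the term l - d never
   decides; otherwise r - 1 <= [l/2] <= d, and truncated subtraction accounts for l - d. *)
exists (fun r => if (d < l./2)%N then (l - d - minn (r - 1) d)%N
                 else (l - d - (r - 1))%N).
split=> [P P0|led|led].
- have r_bounds := crank_bounds P0; split=> //.
  rewrite dim_vquot dim_binform.
  have := dim_Ann_form P d; have := dim_Ann_formE P0 hd.
  move: (crank P) r_bounds => r r_bounds.
  set x := \dim (Ann_form P d); set y := \dim (limg _).
  by case: (ltnP d l./2); lia.
- by split=> r; case: (ltnP d l./2); lia.
- by split=> r; case: (ltnP d l./2); lia.
Qed.
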